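(* Let $s\ge\frac12$, $a_0\in L_{0,A}(\mathbf C^d)$ and let $$a_0^{\mathrm{aw}}(z,w)=\pi^{-d}\int_{\mathbf C^d}a_0(w_1)e^{-(z-w_1,w-w_1)}\,d\lambda(w_1),\quad z,w\in\mathbf C^d.$$ Then the following is true: (1) if $|a_0(w)|\lesssim e^{-r_0|w|^{1/s}}$ holds for some $r_0>0$, then $|a_0^{\mathrm{aw}}(z,w)|\lesssim e^{\frac14|z-w|^2-r|z+w|^{1/s}}$ for some $r>0$; if $s>\frac12$ and $|a_0(w)|\lesssim e^{-r_0|w|^{1/s}}$ holds for every $r_0>0$, then $|a_0^{\mathrm{aw}}(z,w)|\lesssim e^{\frac14|z-w|^2-r|z+w|^{1/s}}$ for every $r>0$; (2) if $|a_0(w)|\lesssim e^{r_0|w|^{1/s}}$ holds for every $r_0>0$, then $|a_0^{\mathrm{aw}}(z,w)|\lesssim e^{\frac14|z-w|^2+r|z+w|^{1/s}}$ for every $r>0$; if $s>\frac12$ and $|a_0(w)|\lesssim e^{r_0|w|^{1/s}}$ holds for some $r_0>0$, then $|a_0^{\mathrm{aw}}(z,w)|\lesssim e^{\frac14|z-w|^2+r|z+w|^{1/s}}$ for some $r>0$.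
   Context: $(z,w)=\sum_jz_j\overline{w_j}$, $d\lambda$ is Lebesgue measure on $\mathbf C^d$, $\lesssim$ means inequality up to a constant independent of $z,w\in\mathbf C^d$ (possibly depending on $r,r_0$). $L_{0,A}(\mathbf C^d)$ is the set of $a_0\in L^1_{loc}(\mathbf C^d)$ such that $w\mapsto a_0(w)e^{r|w|-|w|^2}\in L^1(\mathbf C^d)$ for every $r>0$. The function $a_0^{\mathrm{aw}}$ is the Wick symbol of the anti-Wick operator $F\mapsto\pi^{-d}\int a_0(w)F(w)e^{(\cdot-w,w)}d\lambda(w)$. *)

(* Defs.v *)
From HB Require Import structures.
From mathcomp Require Import all_boot all_order all_algebra.
From mathcomp Require Import complex.
From mathcomp Require Import all_classical all_reals all_analysis.

Set Implicit Arguments.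
Unset Strict Implicit.
Unset Printing Implicit Defensive.

Import Order.TTheory GRing.Theory Num.Theory.
Import numFieldNormedType.Exports.
Import ComplexField.Normc.

Local Open Scope classical_set_scope.
Local Open Scope ring_scope.
Local Open Scope complex_scope.

(* R[i] gets the topology of the norm; the library puts it on R[i]^o only. *)
HB.instance Definition _ (R : realType) :=
  PseudoPointedMetric.copy R[i] (R[i])^o.

(* The Borel sets of the plane, transported along z |-> (Re z, Im z). *)
Section measurable_complex.
Context {R : realType}.

Let to_prod (z : R[i]) : measurableTypeR R * measurableTypeR R :=
  (complex.Re z, complex.Im z).

Let measurableC0 : preimage_set_system setT to_prod measurable set0.
Proof. by exists set0 => //; rewrite preimage_set0 setI0. Qed.

Let measurableCC A : preimage_set_system setT to_prod measurable A ->
  preimage_set_system setT to_prod measurable (~` A).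
Proof. by case=> B mB <-; exists (~` B); [exact: measurableC|rewrite !setTI]. Qed.

Let measurableC_bigcup (F : (set R[i])^nat) :
  (forall i, preimage_set_system setT to_prod measurable (F i)) ->
  preimage_set_system setT to_prod measurable (\bigcup_i F i).
Proof.
move=> mF; have /choice[G GF] : forall i, exists B, measurable B /\
    to_prod @^-1` B = F i.
  by move=> i; have [B mB <-] := mF i; exists B; rewrite setTI.
exists (\bigcup_i G i); first by apply: bigcup_measurable => i _; case: (GF i).
by rewrite setTI preimage_bigcup; apply: eq_bigcupr => i _; case: (GF i).
Qed.

HB.instance Definition _ := @isMeasurable.Build default_measure_display
  R[i] (preimage_set_system setT to_prod measurable)
  measurableC0 measurableCC measurableC_bigcup.

End measurable_complex.

(* The product sigma-algebra, as for [n.-tuple T] in the library. *)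
Section measurable_rV.
Context {d} {T : measurableType d} {n : nat}.

Let coord (i : 'I_n) (x : 'rV[T]_n) : T := x ord0 i.

Let rV_set0 : g_sigma_preimage coord set0.
Proof. exact: sigma_algebra0. Qed.

Let rV_setC A : g_sigma_preimage coord A -> g_sigma_preimage coord (~` A).
Proof. exact: sigma_algebraC. Qed.

Let rV_bigcup (F : _^nat) : (forall i, g_sigma_preimage coord (F i)) ->
  g_sigma_preimage coord (\bigcup_i (F i)).
Proof. exact: sigma_algebra_bigcup. Qed.

HB.instance Definition _ := @isMeasurable.Build (measure_tuple_display d)
  'rV[T]_n (g_sigma_preimage coord) rV_set0 rV_setC rV_bigcup.

End measurable_rV.

Section coordinates.
Local Open Scope ereal_scope.

Lemma measurable_Re (R : realType) :
  measurable_fun [set: R[i]] (@complex.Re R : R[i] -> measurableTypeR R).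
Proof.
move=> _ B mB; exists (B `*` setT); first exact: measurableX.
by rewrite !setTI; apply/seteqP; split=> z //= -[].
Qed.

Lemma measurable_Im (R : realType) :
  measurable_fun [set: R[i]] (@complex.Im R : R[i] -> measurableTypeR R).
Proof.
move=> _ B mB; exists (setT `*` B); first exact: measurableX.
by rewrite !setTI; apply/seteqP; split=> z //= -[].
Qed.

Definition mkcomplex (R : realType)
  (p : measurableTypeR R * measurableTypeR R) : R[i] := p.1 +i* p.2.

Lemma measurable_mkcomplex (R : realType) :
  measurable_fun setT (@mkcomplex R).
Proof.
move=> _ _ [B mB <-]; rewrite !setTI.
by rewrite [X in measurable X](_ : _ = B)//; apply/seteqP; split=> -[].
Qed.

Lemma measurable_coord d (T : measurableType d) n (i : 'I_n) :
  measurable_fun [set: 'rV[T]_n] (fun x : 'rV[T]_n => x ord0 i).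
Proof.
move=> _ Y mY; rewrite setTI; apply: sub_sigma_algebra => /=.
rewrite -bigcup_seq/=; exists i => /=; first by rewrite mem_index_enum.
by exists Y => //; rewrite setTI.
Qed.

Lemma measurable_fun_coordP d1 d2 (T1 : measurableType d1)
    (T2 : measurableType d2) n (f : T1 -> 'rV[T2]_n) :
  (forall i, measurable_fun setT (fun x => f x ord0 i)) ->
  measurable_fun setT f.
Proof.
move=> mf.
have H : g_sigma_preimage (fun i => (fun x : 'rV[T2]_n => x ord0 i) \o f)
    `<=` measurable.
  apply: smallest_sub; first exact: sigma_algebra_measurable.
  elim/big_ind : _ => //; first by move=> X Y ? ?; rewrite subUset.
  by move=> i _ A [B mB <-]; exact: mf.
rewrite g_sigma_preimage_comp in H.
by move=> _ A mA; apply: H; exists A.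
Qed.

Definition rV_cons (T : Type) n (p : T * 'rV[T]_n) : 'rV[T]_n.+1 :=
  row_mx (const_mx p.1 : 'rV_1) p.2.

Lemma rV_consE0 (T : Type) n (p : T * 'rV[T]_n) : rV_cons p ord0 ord0 = p.1.
Proof.
rewrite (_ : ord0 = lshift n ord0 :> 'I_(1 + n)); last exact/val_inj.
by apply: (etrans (row_mxEl _ _ _ _)); rewrite mxE.
Qed.

Lemma rV_consES (T : Type) n (p : T * 'rV[T]_n) j :
  rV_cons p ord0 (lift ord0 j) = p.2 ord0 j.
Proof.
rewrite (_ : lift ord0 j = rshift 1 j :> 'I_(1 + n)); last exact/val_inj.
exact: row_mxEr.
Qed.

Lemma measurable_rV_cons d (T : measurableType d) n :
  measurable_fun [set: T * 'rV[T]_n] (@rV_cons T n).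
Proof.
apply: measurable_fun_coordP => i; have [j ->|->] := unliftP ord0 i.
  rewrite (_ : (fun _ => _) = (fun v : 'rV[T]_n => v ord0 j) \o snd).
    by apply: measurableT_comp; [exact: measurable_coord|].
  by apply/funext => x; rewrite rV_consES.
rewrite (_ : (fun _ => _) = fst) //.
by apply/funext => x; rewrite rV_consE0.
Qed.

Definition rV_uncons (T : Type) n (v : 'rV[T]_n.+1) : T * 'rV[T]_n :=
  (v ord0 ord0, \row_j v ord0 (lift ord0 j)).

Lemma rV_consK (T : Type) n : cancel (@rV_cons T n) (@rV_uncons T n).
Proof.
case=> x v; rewrite /rV_uncons rV_consE0; congr pair.
by apply/rowP => j; rewrite mxE rV_consES.
Qed.

Lemma measurable_rV_uncons d (T : measurableType d) n :
  measurable_fun [set: 'rV[T]_n.+1] (@rV_uncons T n).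
Proof.
apply/measurable_fun_pairP; split; first exact: measurable_coord.
apply: measurable_fun_coordP => i.
rewrite (_ : (fun _ => _) = (fun v : 'rV[T]_n.+1 => v ord0 (lift ord0 i))).
  exact: measurable_coord.
by apply/funext => v; rewrite mxE.
Qed.

(* The instance of this fact in the library is shadowed by an earlier one,
   stated for a pair of finite measures. *)
Lemma sigma_finite_product_measure1 (R : realType) d1 d2
    (T1 : measurableType d1) (T2 : measurableType d2)
    (m1 : {sigma_finite_measure set T1 -> \bar R})
    (m2 : {sigma_finite_measure set T2 -> \bar R}) :
  sigma_finite setT (m1 \x m2).
Proof.
have /sigma_finiteP[F [TF ndF Foo]] := sigma_finiteT m1.
have /sigma_finiteP[G [TG ndG Goo]] := sigma_finiteT m2.
exists (fun n => F n `*` G n).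
  rewrite -setXTT TF TG predeqE => -[x y]; split.
    move=> [/= [n _ Fnx] [k _ Gky]]; exists (maxn n k) => //; split.
    - by move: x Fnx; exact/subsetPset/ndF/leq_maxl.
    - by move: y Gky; exact/subsetPset/ndG/leq_maxr.
  by move=> [n _ []/= ? ?]; split; exists n.
move=> k; have [? ?] := Foo k; have [? ?] := Goo k.
split; first exact: measurableX.
by rewrite product_measure1E// lte_mul_pinfty// ge0_fin_numE.
Qed.

Lemma sigma_finite_pushforward (R : realType) d1 d2 (T1 : measurableType d1)
    (T2 : measurableType d2) (m : set T1 -> \bar R) (f : T1 -> T2) (g : T2 -> T1) :
  sigma_finite setT m -> measurable_fun setT g -> cancel f g ->
  sigma_finite setT (pushforward m f).
Proof.
move=> [F TF mF] mg fK.
exists (fun n => g @^-1` F n).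
  by rewrite -preimage_bigcup -TF preimage_setT.
move=> n; have [mFn Fn] := mF n; split.
  by rewrite -[X in measurable X]setTI; exact: mg.
rewrite /pushforward -comp_preimage (_ : g \o f = id) //.
by apply/funext => x /=; rewrite fK.
Qed.

End coordinates.

Section lebesgue_measureC.
Context {R : realType}.
Local Open Scope ereal_scope.

Definition lebesgue_measureC : set R[i] -> \bar R :=
  pushforward (@lebesgue_measure R \x @lebesgue_measure R) (@mkcomplex R).

HB.instance Definition _ :=
  isMeasurableFun.Build _ _ _ _ (@mkcomplex R) (@measurable_mkcomplex R).

Let lebesgue_measureC0 : lebesgue_measureC set0 = 0.
Proof. exact: measure0. Qed.

Let lebesgue_measureC_ge0 A : 0 <= lebesgue_measureC A.
Proof. exact: measure_ge0. Qed.

Let lebesgue_measureC_sigma_additive : semi_sigma_additive lebesgue_measureC.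
Proof. exact: measure_semi_sigma_additive. Qed.

HB.instance Definition _ := isMeasure.Build _ _ _ lebesgue_measureC
  lebesgue_measureC0 lebesgue_measureC_ge0 lebesgue_measureC_sigma_additive.

Let lebesgue_measureC_sigma_finite : sigma_finite setT lebesgue_measureC.
Proof.
pose g (z : R[i]) : measurableTypeR R * measurableTypeR R :=
  (complex.Re z, complex.Im z).
apply: (sigma_finite_pushforward (g := g)).
- exact: sigma_finite_product_measure1.
- by apply: measurable_fun_pair; [exact: measurable_Re|exact: measurable_Im].
- by case.
Qed.

HB.instance Definition _ := Measure_isSigmaFinite.Build _ _ _ lebesgue_measureC
  lebesgue_measureC_sigma_finite.

Lemma lebesgue_measureCE (A B : set (measurableTypeR R)) :
  measurable A -> measurable B ->
  lebesgue_measureC [set z | A (complex.Re z) /\ B (complex.Im z)] =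
  lebesgue_measure A * lebesgue_measure B.
Proof. by move=> mA mB; rewrite -product_measure1E. Qed.

End lebesgue_measureC.

(* [rV_measure m n] is the n-fold product of m with itself; see [rV_measureE]. *)
Section rV_measure.
Context d (T : measurableType d) (R : realType).
Variable m : {sigma_finite_measure set T -> \bar R}.
Local Open Scope ereal_scope.

Section cons.
Variables (n : nat) (mn : {sigma_finite_measure set 'rV[T]_n -> \bar R}).

Definition rV_cons_measure : set 'rV[T]_n.+1 -> \bar R :=
  pushforward (m \x mn) (@rV_cons T n).

HB.instance Definition _ :=
  isMeasurableFun.Build _ _ _ _ (@rV_cons T n) (@measurable_rV_cons _ T n).

Let rV_cons_measure0 : rV_cons_measure set0 = 0.
Proof. exact: measure0. Qed.

Let rV_cons_measure_ge0 A : 0 <= rV_cons_measure A.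
Proof. exact: measure_ge0. Qed.

Let rV_cons_measure_sigma_additive : semi_sigma_additive rV_cons_measure.
Proof. exact: measure_semi_sigma_additive. Qed.

HB.instance Definition _ := isMeasure.Build _ _ _ rV_cons_measure
  rV_cons_measure0 rV_cons_measure_ge0 rV_cons_measure_sigma_additive.

Let rV_cons_measure_sigma_finite : sigma_finite setT rV_cons_measure.
Proof.
apply: (sigma_finite_pushforward _ (@measurable_rV_uncons _ T n)
  (@rV_consK T n)).
exact: sigma_finite_product_measure1.
Qed.

HB.instance Definition _ := Measure_isSigmaFinite.Build _ _ _ rV_cons_measure
  rV_cons_measure_sigma_finite.

End cons.

Fixpoint rV_measure n : {sigma_finite_measure set 'rV[T]_n -> \bar R} :=
  match n with
  | 0 => [the {sigma_finite_measure set 'rV[T]_0 -> \bar R} of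
            \d_(\row_i point : 'rV[T]_0)]
  | n.+1 => [the {sigma_finite_measure set 'rV[T]_n.+1 -> \bar R} of
            rV_cons_measure (rV_measure n)]
  end.

Lemma measurable_rV_box n (A : 'I_n -> set T) : (forall i, measurable (A i)) ->
  measurable [set v : 'rV[T]_n | forall i, A i (v ord0 i)].
Proof.
move=> mA; rewrite (_ : [set _ | _] =
    \bigcap_(i in [set: 'I_n]) (fun v : 'rV[T]_n => v ord0 i) @^-1` A i).
  apply: fin_bigcap_measurable => // i _.
  by rewrite -[X in measurable X]setTI; exact: measurable_coord.
by apply/seteqP; split=> v /= H i; [move=> _|]; exact: H.
Qed.

Lemma rV_measureE n (A : 'I_n -> set T) : (forall i, measurable (A i)) ->
  rV_measure n [set v : 'rV[T]_n | forall i, A i (v ord0 i)] =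
  \prod_(i < n) m (A i).
Proof.
elim: n A => [|n ih] A mA.
  by rewrite big_ord0 /= diracE mem_set// => -[].
rewrite big_ord_recl -ih//= /rV_cons_measure /pushforward.
rewrite -(product_measure1E m (rV_measure n) (mA ord0)
  (measurable_rV_box (fun i => mA (lift ord0 i)))).
congr product_measure1; apply/seteqP; split=> -[x v] /=.
  move=> H; split; first by move: (H ord0); rewrite rV_consE0.
  by move=> i; move: (H (lift ord0 i)); rewrite rV_consES.
move=> [Ax Av] i; have [j ->|->] := unliftP ord0 i.
  by rewrite rV_consES; exact: Av.
by rewrite rV_consE0.
Qed.

End rV_measure.

Definition lebesgue_measureCn (R : realType) (n : nat) :
  {sigma_finite_measure set 'rV[R[i]]_n -> \bar R} :=
  rV_measure (@lebesgue_measureC R) n.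

Section complex_integral.
Context d (T : measurableType d) (R : realType).
Variable mu : {measure set T -> \bar R}.

Definition integrableC (D : set T) (f : T -> R[i]) : Prop :=
  measurable_fun D f /\ (\int[mu]_(x in D) (normc (f x))%:E < +oo)%E.

(* A junk value unless [integrableC D f]. *)
Definition integralC (D : set T) (f : T -> R[i]) : R[i] :=
  (\int[mu]_(x in D) complex.Re (f x)) +i* (\int[mu]_(x in D) complex.Im (f x)).

End complex_integral.

Definition expC (R : realType) (z : R[i]) : R[i] :=
  (expR (complex.Re z))%:C * (cos (complex.Im z) +i* sin (complex.Im z)).

Section Cn.
Context {R : realType} {d : nat}.
Implicit Types (z w : 'rV[R[i]]_d) (f : 'rV[R[i]]_d -> R[i]).

Definition dotC z w : R[i] := \sum_(j < d) z ord0 j * conjc (w ord0 j).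

(* The norm of ['rV_d] in the library is the sup norm. *)
Definition normCn z : R := Num.sqrt (complex.Re (dotC z z)).

(* Elements of L^1_loc are represented by Borel functions: every class of
   Lebesgue measurable functions modulo null sets contains one. *)
Definition locally_integrableC f : Prop :=
  measurable_fun setT f /\
  forall K : set 'rV[R[i]]_d, compact K ->
    (\int[lebesgue_measureCn R d]_(w in K) (normc (f w))%:E < +oo)%E.

Definition L0A f : Prop :=
  locally_integrableC f /\
  forall r : R, 0 < r ->
    integrableC (lebesgue_measureCn R d) setT
      (fun w => f w * (expR (r * normCn w - normCn w ^+ 2))%:C).

Definition antiWick_symbol f z w : R[i] :=
  (pi ^- d)%:C *
  integralC (lebesgue_measureCn R d) setT
    (fun w1 => f w1 * expC (- dotC (z - w1) (w - w1))).

(* An element of L^1_loc is only defined up to null sets, hence the bound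
   almost everywhere. *)
Definition lesssim_ae f (g : 'rV[R[i]]_d -> R) : Prop :=
  exists C : R,
    {ae lebesgue_measureCn R d, forall w, normc (f w) <= C * g w}.

Definition lesssim (F : 'rV[R[i]]_d -> 'rV[R[i]]_d -> R[i])
    (G : 'rV[R[i]]_d -> 'rV[R[i]]_d -> R) : Prop :=
  exists C : R, forall z w, normc (F z w) <= C * G z w.

End Cn.

(* Main.v *)
(* Put u = (z + w) / 2. Polarization gives
     |exp (- (z - v, w - v))| = exp (|z - w|^2 / 4 - |v - u|^2),
   so everything reduces to bounding |a0(v)| exp (- |v - u|^2). With
   p = 1 / s in (0, 2], quasi-subadditivity of t |-> t^p lets one trade |v|^p
   for |z + w|^p at the cost of a term c |v - u|^p, which is at most
   K + |v - u|^2 / 2, either because p < 2 or because c <= 1/2. The remaining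
   factor exp (- |v - u|^2 / 2) has an integral independent of u. *)

Require Import Defs.
From mathcomp Require Import all_boot all_order all_algebra.
From mathcomp Require Import complex.
From mathcomp Require Import all_classical all_reals all_analysis.
From mathcomp Require Import ring lra.
From mathcomp Require Import measurable_realfun normal_distribution.

Import Order.TTheory GRing.Theory Num.Theory.
Import numFieldNormedType.Exports.
Import ComplexField.Normc.

Local Open Scope classical_set_scope.
Local Open Scope ring_scope.

(** * Elementary inequalities between powers *)

Section growth.
Context {R : realType}.
Implicit Types p c x : R.

(** If [b] is the larger of [a] and [b], the hypothesis gives x^2 <= 16 b^2, so x <= 4 b. Then x^p
    <= 4^p b^p, and 4^p <= 4^2 = 16 because p <= 2. *)
Lemma powR_le_sqr_add p (a b x : R) : 0 <= p <= 2 ->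
  0 <= x -> 0 <= a -> 0 <= b -> x ^+ 2 <= 8 * (a ^+ 2 + b ^+ 2) ->
  x `^ p <= 16 * (a `^ p + b `^ p).
Proof.
move=> /andP[p0 p2] x0 a0 b0 xab.
wlog ab : a b a0 b0 xab / a <= b.
  move=> H; have [/H|/ltW ba] := leP a b; first exact.
  by rewrite addrC; apply: H => //; rewrite addrC.
have xb : x <= 4 * b.
  rewrite -ler_sqr ?nnegrE ?mulr_ge0//.
  have : a ^+ 2 <= b ^+ 2 by rewrite ler_sqr ?nnegrE.
  by move: xab; rewrite exprMn; lra.
have p4 : 4 `^ p <= 16 :> R.
  apply: (@le_trans _ _ (4 `^ 2)); first by rewrite ler_powR// ler1n.
  by rewrite powR_mulrn//; lra.
apply: (@le_trans _ _ ((4 * b) `^ p)).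
  by apply: ge0_ler_powR; rewrite ?nnegrE ?mulr_ge0.
rewrite powRM// (@le_trans _ _ (16 * b `^ p))// ?ler_wpM2r ?powR_ge0//.
by rewrite ler_wpM2l// lerDr powR_ge0.
Qed.

(** For p < 2 the square wins beyond a threshold, whatever [c] is. At p = 2 there is no room left,
    and c <= 1/2 takes over: x^p <= 1 + x^2 then suffices. *)
Lemma powR_le_half_sqr p c : 0 <= p -> 0 <= c -> p < 2 \/ p <= 2 /\ c <= 1 / 2 ->
  exists K, forall x, 0 <= x -> c * x `^ p <= K + x ^+ 2 / 2.
Proof.
move=> p0 c0 [p2|[p2 c2]]; last first.
  exists (1 / 2) => x x0.
  have xp : x `^ p <= 1 + x ^+ 2.
    have [x1|/ltW x1] := leP x 1.
      rewrite -[leLHS]addr0 lerD ?sqr_ge0//.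
      (* The bound 1 is read as 1^p, so that monotonicity in the base applies. *)
      by rewrite -[leRHS]/((fun=> 1) p) -powR1 ge0_ler_powR ?nnegrE.
    by rewrite (le_trans (ler_powR x1 p2))// powR_mulrn// lerDr.
  have := powR_ge0 x p; have := sqr_ge0 x; nra.
(* [M] solves M^(2 - p) = 2 c + 1. Beyond it, x^2 = x^(2 - p) x^p >= 2 c x^p; below it, c M^p is a
   bound. The added 1 keeps [M] positive when c = 0. *)
set M := (2 * c + 1) `^ (2 - p)^-1.
have M0 : 0 < M by rewrite powR_gt0; lra.
have ML : M `^ (2 - p) = 2 * c + 1.
  by rewrite -powRrM mulVf ?powRr1//; lra.
exists (c * M `^ p) => x x0; have [xM|/ltW Mx] := leP x M.
  rewrite -[leLHS]addr0 lerD ?divr_ge0 ?sqr_ge0// ler_wpM2l//.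
  by rewrite ge0_ler_powR ?nnegrE// ltW.
have : x ^+ 2 = x `^ (2 - p) * x `^ p.
  by rewrite -powR_mulrn// -powRD ?subrK// pnatr_eq0.
have : 2 * c + 1 <= x `^ (2 - p).
  by rewrite -ML ge0_ler_powR ?nnegrE//; lra.
have := powR_ge0 x p; have := mulr_ge0 c0 (powR_ge0 M p); nra.
Qed.

End growth.

(** * Product integrals and Gaussian integrals on R and C *)

Section gauss.
Local Open Scope ereal_scope.
Context {R : realType}.

(** Induction on [n]: the measure in dimension n + 1 is the image of a product measure under
    [rV_cons], so Tonelli splits off coordinate 0. *)
Lemma ge0_integral_rV_measure_prod d (T : measurableType d)
    (m : {sigma_finite_measure set T -> \bar R}) n (g : 'I_n -> T -> R) :
  (forall i, measurable_fun setT (g i)) -> (forall i x, (0 <= g i x)%R) ->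
  \int[rV_measure m n]_v (\prod_(i < n) g i (v ord0 i))%:E =
  \prod_(i < n) \int[m]_x (g i x)%:E.
Proof.
elim: n g => [|n ih] g mg g0.
  rewrite big_ord0 /=.
  under eq_integral do rewrite big_ord0.
  (* In dimension 0 the measure is a Dirac mass; its total mass 1 matches the empty product. *)
  by rewrite integral_cst//= mul1e diracT.
have mprod k (h : 'I_k -> T -> R) : (forall i, measurable_fun setT (h i)) ->
    measurable_fun setT (EFin \o (fun v : 'rV[T]_k => (\prod_(i < k) h i (v ord0 i))%R)).
  move=> mh; apply/measurable_EFinP; apply: measurable_prod => i _.
  by apply: measurableT_comp => //; exact: measurable_coord.
rewrite /= /rV_cons_measure (ge0_integral_pushforward (@measurable_rV_cons _ T n))//=; last 2 first.
- exact: mprod.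
- by move=> v _; rewrite lee_fin prodr_ge0.
rewrite preimage_setT fubini_tonelli1//=; last 2 first.
- by apply: (measurableT_comp (mprod _ _ mg)); exact: measurable_rV_cons.
- by move=> v; rewrite lee_fin prodr_ge0.
(* The product of the remaining integrals goes back under the integral as a constant, so that both
   sides can be compared pointwise in the first coordinate. *)
rewrite big_ord_recl -ge0_integralZr//; last 3 first.
- exact/measurable_EFinP.
- by move=> x _; rewrite lee_fin.
- by apply: prode_ge0 => i _; apply: integral_ge0 => x _; rewrite lee_fin.
apply: eq_integral => x _; rewrite /fubini_F -ih//.
rewrite -ge0_integralZl//; last 3 first.
- by apply: (mprod n (fun i => g (lift ord0 i))) => i; exact: mg.
- by move=> v _; rewrite lee_fin prodr_ge0.
- by rewrite lee_fin.
apply: eq_integral => v _.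
rewrite big_ord_recl rV_consE0 EFinM/=; congr (_ * _%:E).
by apply: eq_bigr => i _; rewrite rV_consES.
Qed.

(** The integrand is the normal density of mean [m] and variance 1, of mass 1, divided by its peak 1
    / sqrt(2 pi). *)
Lemma integral_gauss (m : R) :
  \int[lebesgue_measure]_x (expR (- (2^-1 * (x - m) ^+ 2)))%:E =
  ((normal_peak 1)^-1)%:E.
Proof.
have p0 : (normal_peak 1 != 0 :> R)%R by rewrite gt_eqF// normal_peak_gt0.
have gE x : (expR (- (2^-1 * (x - m) ^+ 2)))%:E =
    (normal_peak 1)^-1%:E * (normal_pdf m 1 x)%:E.
  rewrite normal_pdfE//= -EFinM mulKf//; congr (expR _)%:E.
  by rewrite expr1n mulrC mulNr.
under eq_integral do rewrite gE.
rewrite ge0_integralZl// ?integral_normal_pdf ?mule1//.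
- by apply/measurable_EFinP; exact: measurable_normal_pdf.
- by move=> x _; rewrite lee_fin normal_pdf_ge0.
- by rewrite lee_fin invr_ge0 normal_peak_ge0.
Qed.

(** The Gaussian factors into one in the real part and one in the imaginary part; Tonelli then gives
    the square of the integral on the line. *)
Lemma integral_gaussC (c : R[i]) :
  \int[lebesgue_measureC]_z
    (expR (- (2^-1 * ((complex.Re z - complex.Re c) ^+ 2 +
                      (complex.Im z - complex.Im c) ^+ 2))))%:E =
  ((normal_peak 1)^-1 ^+ 2)%:E.
Proof.
rewrite /lebesgue_measureC.
rewrite (ge0_integral_pushforward (@measurable_mkcomplex R))//=; last first.
  apply/measurable_EFinP; apply: measurableT_comp => //.
  by apply: measurableT_comp => //; apply: measurable_funM => //;
    apply: measurable_funD; apply: measurable_funX; apply: measurable_funB => //;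
    [exact: measurable_Re|exact: measurable_Im].
pose g (m x : R) := expR (- (2^-1 * (x - m) ^+ 2)).
have mg m : measurable_fun setT (g m).
  apply: measurableT_comp => //.
  by apply: measurableT_comp => //; apply: measurable_funM => //;
    apply: measurable_funX; apply: measurable_funB.
have mgE m : measurable_fun [set: measurableTypeR R] (EFin \o g m).
  by apply/measurable_EFinP; exact: mg.
have gM x y : (expR (- (2^-1 * ((x - complex.Re c) ^+ 2 + (y - complex.Im c) ^+ 2))) =
    g (complex.Re c) x * g (complex.Im c) y)%R.
  by rewrite /g -expRD; congr expR; ring.
under eq_integral do rewrite gM.
rewrite preimage_setT fubini_tonelli1//=; last 2 first.
- apply/measurable_EFinP; apply: measurable_funM.
    by apply: measurableT_comp; [exact: mg|exact: measurable_fst].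
  by apply: measurableT_comp; [exact: mg|exact: measurable_snd].
- by move=> z; rewrite lee_fin mulr_ge0 ?expR_ge0.
rewrite /fubini_F /=.
transitivity (\int[lebesgue_measure]_x
    ((g (complex.Re c) x)%:E * ((normal_peak 1)^-1)%:E)).
  apply: eq_integral => x _; under eq_integral do rewrite EFinM.
  rewrite ge0_integralZl ?integral_gauss//; first exact: mgE.
  - by move=> y _; rewrite lee_fin expR_ge0.
  - by rewrite lee_fin expR_ge0.
rewrite ge0_integralZr//.
- by rewrite integral_gauss.
- exact: mgE.
- by move=> x _; rewrite lee_fin expR_ge0.
- by rewrite lee_fin invr_ge0 normal_peak_ge0.
Qed.

End gauss.

(** * Additivity of real and imaginary parts *)

Section ReIm.
Context {R : realType}.
Implicit Types x y : R[i].

Lemma ReB x y : complex.Re (x - y) = complex.Re x - complex.Re y.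
Proof. by case: x y => ? ? []. Qed.

Lemma ImB x y : complex.Im (x - y) = complex.Im x - complex.Im y.
Proof. by case: x y => ? ? []. Qed.

Lemma ReD x y : complex.Re (x + y) = complex.Re x + complex.Re y.
Proof. by case: x y => ? ? []. Qed.

Lemma ImD x y : complex.Im (x + y) = complex.Im x + complex.Im y.
Proof. by case: x y => ? ? []. Qed.

End ReIm.

(** * The Hermitian form, the midpoint and the Gaussian on C^d *)

Section Cn.
Context {R : realType} {d : nat}.
Implicit Types (z w v : 'rV[R[i]]_d).

Lemma Re_dotC z w : complex.Re (dotC z w) =
  \sum_(j < d) (complex.Re (z ord0 j) * complex.Re (w ord0 j) +
                complex.Im (z ord0 j) * complex.Im (w ord0 j)).
Proof.
rewrite /dotC (big_morph (@complex.Re R) (id1 := 0) (op1 := +%R))//; last first.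
  by case=> ? ? [].
by apply: eq_bigr => j _; case: (z _ _) (w _ _) => [a b] [? ?] /=; rewrite mulrN opprK.
Qed.

Lemma Im_dotC z w : complex.Im (dotC z w) =
  \sum_(j < d) (complex.Im (z ord0 j) * complex.Re (w ord0 j) -
                complex.Re (z ord0 j) * complex.Im (w ord0 j)).
Proof.
rewrite /dotC (big_morph (@complex.Im R) (id1 := 0) (op1 := +%R))//; last first.
  by case=> ? ? [].
by apply: eq_bigr => j _; case: (z _ _) (w _ _) => [a b] [? ?] /=; rewrite mulrN addrC.
Qed.

Lemma normCn_ge0 z : 0 <= normCn z.
Proof. exact: sqrtr_ge0. Qed.

Lemma normCn_sqr z : normCn z ^+ 2 =
  \sum_(j < d) (complex.Re (z ord0 j) ^+ 2 + complex.Im (z ord0 j) ^+ 2).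
Proof.
by rewrite sqr_sqrtr Re_dotC//; apply: sumr_ge0 => j _; rewrite addr_ge0 ?sqr_ge0.
Qed.

(** Spelled out in real and imaginary parts, so that statements about it reduce coordinatewise to
    real polynomial algebra. *)
Definition midpoint z w : 'rV[R[i]]_d := \row_j
  ((complex.Re (z ord0 j) + complex.Re (w ord0 j)) / 2 +i*
   ((complex.Im (z ord0 j) + complex.Im (w ord0 j)) / 2))%C.

(* Polarization: with [z - v = (u - v) + (z - w) / 2] and
   [w - v = (u - v) - (z - w) / 2] the cross terms are purely imaginary. *)
Lemma Re_dotC_midpoint z w v : complex.Re (dotC (z - v) (w - v)) =
  normCn (v - midpoint z w) ^+ 2 - 1 / 4 * normCn (z - w) ^+ 2.
Proof.
rewrite Re_dotC !normCn_sqr mulr_sumr -sumrB; apply: eq_bigr => j _.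
by rewrite !mxE !ReB !ImB /=; field.
Qed.

(** With [u] the midpoint, z + w = 2 v - 2 (v - u), and |x - y|^2 <= 2 |x|^2 + 2 |y|^2 gives the
    constant 8. *)
Lemma normCn_add_le z w v :
  normCn (z + w) ^+ 2 <= 8 * (normCn v ^+ 2 + normCn (v - midpoint z w) ^+ 2).
Proof.
rewrite !normCn_sqr -big_split mulr_sumr; apply: ler_sum => j _ /=.
rewrite !mxE !ReB !ImB ReD ImD /=.
set a := complex.Re (z _ _) + _; set b := complex.Im (z _ _) + _.
(* In each coordinate the right side minus the left side is exactly the sum of these two squares. *)
have := sqr_ge0 (4 * complex.Re (v ord0 j) - a).
have := sqr_ge0 (4 * complex.Im (v ord0 j) - b).
lra.
Qed.

(** The converse trade, from v = (z + w) / 2 + (v - u). The constant 8 is the one that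
    [powR_le_sqr_add] expects. *)
Lemma normCn_le_add z w v :
  normCn v ^+ 2 <= 8 * (normCn (z + w) ^+ 2 + normCn (v - midpoint z w) ^+ 2).
Proof.
rewrite !normCn_sqr -big_split mulr_sumr; apply: ler_sum => j _ /=.
rewrite !mxE !ReB !ImB ReD ImD /=.
set a := complex.Re (z _ _) + _; set b := complex.Im (z _ _) + _.
have := sqr_ge0 (complex.Re (v ord0 j) - a).
have := sqr_ge0 (complex.Im (v ord0 j) - b).
have := sqr_ge0 a. have := sqr_ge0 b.
nra.
Qed.

Lemma normc_expC (x : R[i]) : normc (expC x) = expR (complex.Re x).
Proof.
rewrite normcM /normc /= expr0n /= addr0 cos2Dsin2 sqrtr1 mulr1 sqrtr_sqr.
by rewrite ger0_norm// expR_ge0.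
Qed.

Lemma measurable_Re_coord (j : 'I_d) :
  measurable_fun setT (fun z : 'rV[R[i]]_d => complex.Re (z ord0 j) : R).
Proof. exact: (measurableT_comp (@measurable_Re R) (measurable_coord j)). Qed.

Lemma measurable_Im_coord (j : 'I_d) :
  measurable_fun setT (fun z : 'rV[R[i]]_d => complex.Im (z ord0 j) : R).
Proof. exact: (measurableT_comp (@measurable_Im R) (measurable_coord j)). Qed.

Lemma measurable_normCn_sqr u :
  measurable_fun setT (fun v : 'rV[R[i]]_d => normCn (v - u) ^+ 2).
Proof.
under [X in measurable_fun _ X]eq_fun do rewrite normCn_sqr.
apply: measurable_sum => j.
apply: measurable_funD; apply: measurable_funX.
- under [X in measurable_fun _ X]eq_fun do rewrite !mxE ReB.
  by apply: measurable_funB => //; exact: measurable_Re_coord.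
- under [X in measurable_fun _ X]eq_fun do rewrite !mxE ImB.
  by apply: measurable_funB => //; exact: measurable_Im_coord.
Qed.

Lemma measurable_gaussCn u : measurable_fun setT
  (fun v : 'rV[R[i]]_d => expR (- (2^-1 * normCn (v - u) ^+ 2))).
Proof.
apply: measurableT_comp => //; apply: measurableT_comp => //.
by apply: measurable_funM => //; exact: measurable_normCn_sqr.
Qed.

(** The exponential of a sum over coordinates is a product, so the value is the [d]-th power of the
    integral on C. It does not depend on [u], which makes the final bounds uniform in [z] and
    [w]. *)
Lemma integral_gaussCn u :
  (\int[lebesgue_measureCn R d]_v (expR (- (2^-1 * normCn (v - u) ^+ 2)))%:E =
  (((normal_peak 1)^-1 ^+ 2) ^+ d)%:E)%E.
Proof.
pose g (j : 'I_d) (x : R[i]) : R :=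
  expR (- (2^-1 * ((complex.Re x - complex.Re (u ord0 j)) ^+ 2 +
                   (complex.Im x - complex.Im (u ord0 j)) ^+ 2))).
under eq_integral => v _.
  rewrite (_ : expR _ = \prod_(j < d) g j (v ord0 j)); last first.
    rewrite -expR_sum normCn_sqr mulr_sumr -sumrN; congr expR.
    by apply: eq_bigr => j _; rewrite !mxE ReB ImB.
  over.
rewrite ge0_integral_rV_measure_prod//; last 2 first.
- move=> j; apply: measurableT_comp => //.
  by apply: measurableT_comp => //; apply: measurable_funM => //;
    apply: measurable_funD; apply: measurable_funX; apply: measurable_funB => //;
    [exact: measurable_Re|exact: measurable_Im].
- by move=> j x; exact: expR_ge0.
under eq_bigr do rewrite integral_gaussC.
by rewrite prodEFin prodr_const card_ord.
Qed.

End Cn.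

(** * Bounding a complex integral by an almost everywhere majorant *)

Section domination.
Context d (T : measurableType d) (R : realType).
Variable mu : {measure set T -> \bar R}.

Lemma normr_Rintegral_le (f b : T -> R) (B : R) :
  measurable_fun setT f -> measurable_fun setT b -> (forall x, 0 <= b x) ->
  {ae mu, forall x, `|f x| <= b x} -> (\int[mu]_x (b x)%:E = B%:E)%E ->
  `|\int[mu]_x f x| <= B.
Proof.
move=> mf mb b0 fb iB.
have mEf : measurable_fun setT (EFin \o f) by exact/measurable_EFinP.
have : (`|\int[mu]_x (f x)%:E| <= B%:E)%E.
  apply: (le_trans (le_abse_integral mu measurableT mEf)).
  rewrite -iB; apply: ae_ge0_le_integral => //.
  - exact: measurableT_comp.
  - by move=> x _; rewrite lee_fin.
  - exact/measurable_EFinP.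
  - by apply: filterS fb => x fbx _; rewrite lee_fin.
(* Were the extended integral infinite, its real value would default to 0; the bound just obtained
   excludes that case. *)
by rewrite /Rintegral; case: integral.
Qed.

(** [integralC] treats real and imaginary parts separately, so each is at most [B] in absolute
    value. The factor 2 is crude, but constants are absorbed by [lesssim]. *)
Lemma normc_integralC_le (f : T -> R[i]) (b : T -> R) (B : R) :
  measurable_fun setT (fun x => complex.Re (f x) : R) ->
  measurable_fun setT (fun x => complex.Im (f x) : R) ->
  measurable_fun setT b -> (forall x, 0 <= b x) ->
  {ae mu, forall x, normc (f x) <= b x} -> (\int[mu]_x (b x)%:E = B%:E)%E ->
  normc (integralC mu setT f) <= B *+ 2.
Proof.
move=> mRe mIm mb b0 fb iB; rewrite /integralC /normc.
have Re_le (x : R[i]) : `|complex.Re x| <= normc x.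
  by case: x => x y; rewrite /normc/= -sqrtr_sqr ler_wsqrtr// lerDl sqr_ge0.
have Im_le (x : R[i]) : `|complex.Im x| <= normc x.
  by case: x => x y; rewrite /normc/= -sqrtr_sqr ler_wsqrtr// lerDr sqr_ge0.
have A : `|\int[mu]_x complex.Re (f x)| <= B.
  apply: normr_Rintegral_le mRe mb b0 _ iB.
  by apply: filterS fb => x; exact: le_trans.
have A' : `|\int[mu]_x complex.Im (f x)| <= B.
  apply: normr_Rintegral_le mIm mb b0 _ iB.
  by apply: filterS fb => x; exact: le_trans.
have B0 := le_trans (normr_ge0 _) A.
rewrite -(@ger0_norm _ (B *+ 2)) ?mulrn_wge0// -sqrtr_sqr ler_wsqrtr//.
rewrite -(real_normK (num_real (\int[mu]_x complex.Re (f x)))).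
rewrite -(real_normK (num_real (\int[mu]_x complex.Im (f x)))).
have := normr_ge0 (\int[mu]_x complex.Re (f x)).
have := normr_ge0 (\int[mu]_x complex.Im (f x)).
nra.
Qed.

End domination.

(** * The master estimate for the anti-Wick symbol *)

Section antiWick.
Context {R : realType} {d : nat}.
Implicit Types (z w v : 'rV[R[i]]_d).

(** Two real statements, in the form [normc_integralC_le] takes. The exponent is polynomial in the
    real coordinates of [v], and is composed with exp, cos and sin. *)
Lemma measurable_antiWick_integrand (a0 : 'rV[R[i]]_d -> R[i]) z w :
  measurable_fun setT a0 ->
  measurable_fun setT (fun v => complex.Re (a0 v * expC (- dotC (z - v) (w - v))) : R) /\
  measurable_fun setT (fun v => complex.Im (a0 v * expC (- dotC (z - v) (w - v))) : R).
Proof.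
move=> ma0.
have mRe : measurable_fun setT (fun v => complex.Re (a0 v) : R).
  exact: (measurableT_comp (@measurable_Re R) ma0).
have mIm : measurable_fun setT (fun v => complex.Im (a0 v) : R).
  exact: (measurableT_comp (@measurable_Im R) ma0).
have mReB u j : measurable_fun setT (fun v => complex.Re ((u - v) ord0 j) : R).
  under [X in measurable_fun _ X]eq_fun do rewrite !mxE ReB.
  by apply: measurable_funB => //; exact: measurable_Re_coord.
have mImB u j : measurable_fun setT (fun v => complex.Im ((u - v) ord0 j) : R).
  under [X in measurable_fun _ X]eq_fun do rewrite !mxE ImB.
  by apply: measurable_funB => //; exact: measurable_Im_coord.
have mReq : measurable_fun setT (fun v => complex.Re (- dotC (z - v) (w - v)) : R).
  under [X in measurable_fun _ X]eq_fun do rewrite -[- _]sub0r ReB Re_dotC.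
  apply: measurable_funB => //; apply: measurable_sum => j.
  by apply: measurable_funD; apply: measurable_funM.
have mImq : measurable_fun setT (fun v => complex.Im (- dotC (z - v) (w - v)) : R).
  under [X in measurable_fun _ X]eq_fun do rewrite -[- _]sub0r ImB Im_dotC.
  apply: measurable_funB => //; apply: measurable_sum => j.
  by apply: measurable_funB; apply: measurable_funM.
have mcosq : measurable_fun setT (fun v => cos (complex.Im (- dotC (z - v) (w - v))) : R).
  apply: (measurableT_comp _ mImq).
  by apply: continuous_measurable_fun; exact: continuous_cos.
have msinq : measurable_fun setT (fun v => sin (complex.Im (- dotC (z - v) (w - v))) : R).
  apply: (measurableT_comp _ mImq).
  by apply: continuous_measurable_fun; exact: continuous_sin.
have meq : measurable_fun setT (fun v => expR (complex.Re (- dotC (z - v) (w - v))) : R).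
  exact: measurableT_comp.
split.
- rewrite (_ : (fun _ => _) = fun v =>
    complex.Re (a0 v) * (expR (complex.Re (- dotC (z - v) (w - v))) *
                         cos (complex.Im (- dotC (z - v) (w - v)))) -
    complex.Im (a0 v) * (expR (complex.Re (- dotC (z - v) (w - v))) *
                         sin (complex.Im (- dotC (z - v) (w - v))))).
    by apply: measurable_funB; apply: measurable_funM => //; exact: measurable_funM.
  by apply/funext => v; case: (a0 v) => x y /=; ring.
- rewrite (_ : (fun _ => _) = fun v =>
    complex.Re (a0 v) * (expR (complex.Re (- dotC (z - v) (w - v))) *
                         sin (complex.Im (- dotC (z - v) (w - v)))) +
    complex.Im (a0 v) * (expR (complex.Re (- dotC (z - v) (w - v))) *
                         cos (complex.Im (- dotC (z - v) (w - v))))).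
    by apply: measurable_funD; apply: measurable_funM => //; exact: measurable_funM.
  by apply/funext => v; case: (a0 v) => x y /=; ring.
Qed.

(** The kernel carries the decay exp(- |v - u|^2) around the midpoint [u]. Half of it pays for
    replacing g(v) by K + h(z, w); the other half is integrated over [v] and contributes only a
    constant. *)
Lemma lesssim_antiWick_symbol (a0 : 'rV[R[i]]_d -> R[i])
    (g : 'rV[R[i]]_d -> R) (h : 'rV[R[i]]_d -> 'rV[R[i]]_d -> R) (K : R) :
  measurable_fun setT a0 -> lesssim_ae a0 (fun v => expR (g v)) ->
  (forall z w v, g v <= K + h z w + 2^-1 * normCn (v - midpoint z w) ^+ 2) ->
  lesssim (antiWick_symbol a0)
    (fun z w => expR (1 / 4 * normCn (z - w) ^+ 2 + h z w)).
Proof.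
move=> ma0 [C a0C] gh.
pose N : R := ((normal_peak 1)^-1 ^+ 2) ^+ d.
(* [N] is the Gaussian integral and the factor 2 comes from [normc_integralC_le]. The absolute value
   is taken because [lesssim_ae] puts no sign on [C]. *)
exists (pi ^- d * (`|C| * expR K * N) *+ 2) => z w.
have [mRe mIm] := measurable_antiWick_integrand a0 z w ma0.
pose E := `|C| * expR K * expR (1 / 4 * normCn (z - w) ^+ 2 + h z w).
have E0 : 0 <= E by rewrite !mulr_ge0 ?expR_ge0.
have pid : 0 <= pi ^- d :> R by rewrite invr_ge0 exprn_ge0// pi_ge0.
rewrite /antiWick_symbol normcM {1}/normc /= expr0n addr0 sqrtr_sqr ger0_norm//.
rewrite [leRHS](_ : _ = pi ^- d * ((E * N) *+ 2)); last by rewrite /E; ring.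
rewrite ler_wpM2l//.
apply: (normc_integralC_le _ _ _ _ _ (fun v =>
    E * expR (- (2^-1 * normCn (v - midpoint z w) ^+ 2))) _ mRe mIm).
- by apply: measurable_funM => //; exact: measurable_gaussCn.
- by move=> v; rewrite mulr_ge0 ?expR_ge0.
- apply: filterS a0C => v a0v; rewrite normcM normc_expC.
  rewrite -[- _]sub0r ReB Re_dotC_midpoint.
  apply: (@le_trans _ _ (`|C| * expR (g v) *
      expR (0 - (normCn (v - midpoint z w) ^+ 2 - 1 / 4 * normCn (z - w) ^+ 2)))).
    rewrite ler_wpM2r ?expR_ge0// (le_trans a0v)// ler_wpM2r ?expR_ge0//.
    exact: ler_norm.
  (* After cancelling |C|, only the exponents are compared: g(v) - |v - u|^2 against K + h(z, w) -
     |v - u|^2 / 2, both plus |z - w|^2 / 4. *)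
  rewrite /E -!mulrA -!expRD ler_wpM2l// ler_expR.
  by have := gh z w v; lra.
- under eq_integral do rewrite EFinM.
  rewrite ge0_integralZl//.
  + by rewrite integral_gaussCn.
  + by apply/measurable_EFinP; exact: measurable_gaussCn.
Qed.

End antiWick.

(** * The four estimates, by choice of the rates *)

Theorem theorem4p14 (R : realType) (d : nat) (s : R)
    (a0 : 'rV[R[i]]_d -> R[i]) (hs : 1 / 2 <= s) (ha0 : L0A a0) :
  (((exists2 r0 : R, 0 < r0 &
       lesssim_ae a0 (fun w => expR (- (r0 * normCn w `^ (1 / s))))) ->
    exists2 r : R, 0 < r &
      lesssim (antiWick_symbol a0) (fun z w =>
        expR (1 / 4 * normCn (z - w) ^+ 2 - r * normCn (z + w) `^ (1 / s)))) /\
   (1 / 2 < s ->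
    (forall r0 : R, 0 < r0 ->
       lesssim_ae a0 (fun w => expR (- (r0 * normCn w `^ (1 / s))))) ->
    forall r : R, 0 < r ->
      lesssim (antiWick_symbol a0) (fun z w =>
        expR (1 / 4 * normCn (z - w) ^+ 2 - r * normCn (z + w) `^ (1 / s))))) /\
  (((forall r0 : R, 0 < r0 ->
       lesssim_ae a0 (fun w => expR (r0 * normCn w `^ (1 / s)))) ->
    forall r : R, 0 < r ->
      lesssim (antiWick_symbol a0) (fun z w =>
        expR (1 / 4 * normCn (z - w) ^+ 2 + r * normCn (z + w) `^ (1 / s)))) /\
   (1 / 2 < s ->
    (exists2 r0 : R, 0 < r0 &
       lesssim_ae a0 (fun w => expR (r0 * normCn w `^ (1 / s)))) ->
    exists2 r : R, 0 < r &
      lesssim (antiWick_symbol a0) (fun z w =>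
        expR (1 / 4 * normCn (z - w) ^+ 2 + r * normCn (z + w) `^ (1 / s))))).
Proof.
have ma0 : measurable_fun setT a0 by case: ha0 => -[].
have s0 : 0 < s by lra.
set p := 1 / s.
have p0 : 0 <= p by rewrite divr_ge0// ltW.
have p2 : p <= 2 by rewrite ler_pdivrMr//; lra.
have p2' : 1 / 2 < s -> p < 2 by move=> ?; rewrite ltr_pdivrMr//; lra.
have p02 : 0 <= p <= 2 by rewrite p0.
(* 16 r <= r0 pays for the constant of [powR_le_sqr_add]; 16 r <= 1/2 allows the endpoint p = 2 in
   [powR_le_half_sqr]. *)
have small r0 : 0 < r0 ->
    exists r : R, [/\ 0 < r, 16 * r <= r0 & 16 * r <= 1 / 2].
  move=> r00; exists (Num.min (r0 / 16) (1 / 32)).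
  have : Num.min (r0 / 16) (1 / 32) <= r0 / 16 by rewrite ge_min lexx.
  have : Num.min (r0 / 16) (1 / 32) <= 1 / 32 by rewrite ge_min lexx orbT.
  split; [rewrite lt_min|lra|lra].
  by apply/andP; split; lra.
(* Here r |z + w|^p <= 16 r (|v|^p + |v - u|^p) <= r0 |v|^p + K + |v - u|^2 / 2, so the decay in [v]
   turns into decay in z + w. *)
have decay (r0 r : R) : 0 < r -> 16 * r <= r0 -> p < 2 \/ p <= 2 /\ 16 * r <= 1 / 2 ->
    lesssim_ae a0 (fun w => expR (- (r0 * normCn w `^ p))) ->
    lesssim (antiWick_symbol a0) (fun z w =>
      expR (1 / 4 * normCn (z - w) ^+ 2 - r * normCn (z + w) `^ p)).
  move=> r_gt0 rr0 pr a0b.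
  have [|K HK] := powR_le_half_sqr _ _ p0 _ pr; first by lra.
  apply: (lesssim_antiWick_symbol _ _ _ K ma0 a0b) => z w v.
  have := HK _ (normCn_ge0 (v - midpoint z w)).
  have := powR_le_sqr_add _ _ _ _ p02 (normCn_ge0 (z + w)) (normCn_ge0 v)
    (normCn_ge0 (v - midpoint z w)) (normCn_add_le z w v).
  have := powR_ge0 (normCn v) p.
  nra.
(* The same with [v] and z + w exchanged: r0 |v|^p <= 16 r0 (|z + w|^p + |v - u|^p) <= r |z + w|^p +
   K + |v - u|^2 / 2. *)
have growth (r0 r : R) : 0 < r0 -> 16 * r0 <= r -> p < 2 \/ p <= 2 /\ 16 * r0 <= 1 / 2 ->
    lesssim_ae a0 (fun w => expR (r0 * normCn w `^ p)) ->
    lesssim (antiWick_symbol a0) (fun z w =>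
      expR (1 / 4 * normCn (z - w) ^+ 2 + r * normCn (z + w) `^ p)).
  move=> r0_gt0 rr0 pr a0b.
  have [|K HK] := powR_le_half_sqr _ _ p0 _ pr; first by lra.
  apply: (lesssim_antiWick_symbol _ _ _ K ma0 a0b) => z w v.
  have := HK _ (normCn_ge0 (v - midpoint z w)).
  have := powR_le_sqr_add _ _ _ _ p02 (normCn_ge0 v) (normCn_ge0 (z + w))
    (normCn_ge0 (v - midpoint z w)) (normCn_le_add z w v).
  have := powR_ge0 (normCn (z + w)) p.
  nra.
split; split.
(* The conclusion leaves [r] free, so it is taken small, which also covers s = 1/2. *)
- move=> [r0 r00 a0b]; have [r [r_gt0 ? ?]] := small r0 r00.
  by exists r => //; apply: (decay _ _ _ _ _ a0b) => //; right.
(* Now [r] is prescribed and may be large, so s > 1/2, that is p < 2, is used; the hypothesis is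
   applied at rate 16 r. *)
- move=> /p2' ? a0b r r_gt0.
  by apply: (decay (16 * r)) => //; [left|apply: a0b; lra].
(* The hypothesis holds at every rate, so a small [r0] can be chosen for the given [r], even at p =
   2. *)
- move=> a0b r r_gt0; have [r0 [r00 ? ?]] := small r r_gt0.
  by apply: (growth r0) => //; [right|exact: a0b].
(* With [r0] prescribed, p < 2 absorbs the error term and the rate grows by the factor 16. *)
- move=> /p2' ? [r0 r00 a0b]; exists (16 * r0); first by lra.
  by apply: (growth _ _ _ _ _ a0b) => //; left.
Qed.
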